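(* Let $1\le p<2$, let $T$ be a tree, let $\lambda: T\to(0,\infty)$ be a weight, and let $\varphi:T\to T$ be an injective self-map such that $C_\varphi$ is compact on $L^2_\lambda(T)$. If $$\sum_{u\in T}\Big[\frac{\lambda(\varphi^{-1}(u))}{\lambda(u)}\Big]^{p/2}<\infty,$$ then $C_\varphi\in S_p$.
   Context: A tree $T$ is a connected, locally finite graph without cycles on a countably infinite vertex set (identified with $T$), with a fixed vertex $o$ called the root, and with no terminal vertices (a terminal vertex is one having only one neighbour). For a weight $\lambda:T\to(0,\infty)$, $L^2_\lambda(T)$ is the separable Hilbert space of functions $f:T\to\mathbb{C}$ with $\sum_{v\in T}|f(v)|^2\lambda(v)<\infty$, with inner product $\langle f,g\rangle=\sum_{v\in T}f(v)\overline{g(v)}\lambda(v)$. The composition operator is $C_\varphi f(v)=f(\varphi(v))$. For injective $\varphi$ and $u\in T$, $\lambda(\varphi^{-1}(u))$ denotes $\lambda(w)$ if $w$ is the unique vertex with $\varphi(w)=u$, and $0$ if $u\notin\varphi(T)$. $S_p$ is the Schatten $p$-class of $L^2_\lambda(T)$: the compact operators $A$ whose singular values $\{\mu_n\}$ satisfy $\sum_n|\mu_n|^p<\infty$. *)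

(* Defs.v *)
From HB Require Import structures.
From mathcomp Require Import all_boot all_order all_algebra.
From mathcomp Require Import all_classical all_reals all_analysis.
From mathcomp Require Import ring complex.

Set Implicit Arguments.
Unset Strict Implicit.
Unset Printing Implicit Defensive.

Import Order.TTheory GRing.Theory Num.Theory numFieldNormedType.Exports.
Import ComplexField.Normc.
Import ComplexField.Normc.
Import ComplexField.Normc.
Import ComplexField.Normc.
Import ComplexField.Normc.
Import ComplexField.Normc.
Import ComplexField.Normc.
Import ComplexField.Normc.
Import ComplexField.Normc.
Import ComplexField.Normc.
Import ComplexField.Normc.
Import ComplexField.Normc.
Import ComplexField.Normc.
Import ComplexField.Normc.
Import ComplexField.Normc.
Import ComplexField.Normc.
Import ComplexField.Normc.
Import ComplexField.Normc.

Local Open Scope classical_set_scope.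
Local Open Scope ring_scope.
Local Open Scope complex_scope.

Record tree := Tree {
  vertex :> choiceType;
  adj : rel vertex;
  root : vertex;
  adj_sym : symmetric adj;
  adj_irr : irreflexive adj;
  tree_countable : countable [set: vertex];
  tree_infinite : infinite_set [set: vertex];
  tree_locally_finite : forall v, finite_set [set w | adj v w];
  tree_connected : forall v w, exists s, path adj v s /\ last v s = w;
  (* [:: x; y] with x and y adjacent is a [ucycle], but not a graph cycle *)
  tree_acyclic : forall s, ucycle adj s -> (size s <= 2)%N;
  tree_no_terminal : forall v, ~ exists! w, adj v w
}.

Record weight (R : realType) (T : Type) := Weight {
  weight_fun :> T -> R;
  weight_gt0 : forall v, 0 < weight_fun v
}.

Lemma ge0_esumZl (R : realType) (T : choiceType) (D : set T)
    (a : T -> \bar R) (c : R) : 0 <= c -> (forall v, (0 <= a v)%E) ->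
  (\esum_(v in D) (c%:E * a v) = c%:E * \esum_(v in D) a v)%E.
Proof.
move=> c0 a0; rewrite /esum -ereal_supZl//; last first.
  apply/set0P; exists 0%E, set0; first by split.
  by rewrite fsbig_set0.
congr ereal_sup; apply/seteqP; split => x /=.
- move=> [F FD <-]; exists (\sum_(v \in F) a v)%E; first by exists F.
  exact: ge0_mule_fsumr.
- move=> [_ [F FD <-] <-]; exists F => //; apply/esym.
  exact: ge0_mule_fsumr.
Qed.

Section L2.
Context {R : realType} {T : choiceType} (lam : weight R T).
Implicit Types f g : T -> R[i]^o.

Definition sqnorm f : \bar R :=
  \esum_(v in [set: T]) (normc (f v) ^+ 2 * lam v)%:E.

Definition L2_pred : {pred T -> R[i]^o} := fun f => (sqnorm f < +oo)%E.

Let sqnorm_term_ge0 f v : (0 <= (normc (f v) ^+ 2 * lam v)%:E)%E.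
Proof. by rewrite lee_fin mulr_ge0 ?sqr_ge0// ltW// weight_gt0. Qed.

Lemma sqnorm_ge0 f : (0 <= sqnorm f)%E.
Proof. by apply: esum_ge0 => v _. Qed.

Lemma sqnorm_fin f : f \in L2_pred -> sqnorm f \is a fin_num.
Proof. by move=> fL; rewrite ge0_fin_numE ?sqnorm_ge0. Qed.

Lemma sqnormZ (a : R[i]) f :
  sqnorm (a *: f) = ((normc a ^+ 2)%:E * sqnorm f)%E.
Proof.
rewrite /sqnorm -ge0_esumZl ?sqr_ge0//; apply: eq_esum => v _.
by rewrite -EFinM mulrA -exprMn -normcM.
Qed.

Lemma sqnormD f g (s t : R) : 0 < s -> 0 < t ->
  (sqnorm (f + g)%R%R
    <= (1 + t / s)%R%:E * sqnorm f + (1 + s / t)%R%:E * sqnorm g)%E.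
Proof.
move=> s0 t0.
have ts0 : 0 <= 1 + t / s by rewrite addr_ge0// divr_ge0// ltW.
have st0 : 0 <= 1 + s / t by rewrite addr_ge0// divr_ge0// ltW.
rewrite /sqnorm -!ge0_esumZl// -esumD; first last.
- by move=> v _; rewrite mule_ge0.
- by move=> v _; rewrite mule_ge0.
apply: le_esum => v _; rewrite -!EFinM -EFinD lee_fin !mulrA -mulrDl.
rewrite ler_wpM2r//; first by rewrite ltW// weight_gt0.
have := le_normcD (f v) (g v).
have := @normr_ge0 _ (Rcomplex R) (f v + g v).
rewrite -[`|_|]/(normc (f v + g v)) -[(f + g) v]/(f v + g v).
move: (normc _) (normc (f v)) (normc (g v)) => x a b x0 xab.
apply: (@le_trans _ _ ((a + b) ^+ 2)).
  by rewrite ler_sqr// nnegrE// (le_trans x0).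
have -> : (1 + t / s) * a * a + (1 + s / t) * b * b =
    (a + b) ^+ 2 + (t * a - s * b) ^+ 2 / (s * t).
  by field; rewrite !gt_eqF.
by rewrite lerDl divr_ge0 ?sqr_ge0// mulr_ge0// ltW.
Qed.

Lemma L2_submod_closed : submod_closed L2_pred.
Proof.
split=> [|a f g fL gL]; rewrite unfold_in.
- rewrite (_ : sqnorm 0 = 0%E)//; apply: esum1 => v _.
  by rewrite -[normc _]/(normc (0 : R[i])) normc0 expr0n mul0r.
- apply: (le_lt_trans (sqnormD (a *: f) g ltr01 ltr01)).
  rewrite divr1 lte_add_pinfty ?lte_mul_pinfty ?lee_fin ?addr_ge0//.
  rewrite sqnormZ lte_mul_pinfty ?lee_fin ?sqr_ge0//.
Qed.

HB.instance Definition _ :=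
  GRing.isSubmodClosed.Build _ _ L2_pred L2_submod_closed.

Record L2 := MkL2 { L2_fun :> T -> R[i]^o; L2P : L2_fun \in L2_pred }.

HB.instance Definition _ := [isSub for L2_fun].
HB.instance Definition _ := [Choice of L2 by <:].
HB.instance Definition _ := [SubChoice_isSubLmodule of L2 by <:].

Definition L2_norm (f : L2) : R[i] := (Num.sqrt (fine (sqnorm f)))%:C.

Let L2_normK (f : L2) : (((Num.sqrt (fine (sqnorm f))) ^+ 2)%:E = sqnorm f)%E.
Proof.
by rewrite sqr_sqrtr ?fine_ge0 ?sqnorm_ge0// fineK// sqnorm_fin// L2P.
Qed.

Let L2_norm0_eq0 (f : L2) : L2_norm f = 0 -> f = 0.
Proof.
move=> /(congr1 (@complex.Re R)) /= f0.
have f00 : sqnorm f = 0%E by rewrite -L2_normK f0 expr0n.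
apply/val_inj/funext => v /=.
have : ((normc (f v) ^+ 2 * lam v)%:E <= 0)%E.
  rewrite -[leRHS]f00 -(@esum_set1 _ _ v (fun v => (normc (f v) ^+ 2 * lam v)%:E))//.
  rewrite /sqnorm [leRHS](esumID [set v])// setTI leeDl//.
  exact: esum_ge0.
rewrite lee_fin pmulr_lle0 ?weight_gt0// => nf.
apply: eq0_normc; apply/eqP; rewrite -sqrf_eq0 eq_le nf sqr_ge0//.
Qed.

Let L2_ler_normD (f g : L2) : L2_norm (f + g) <= L2_norm f + L2_norm g.
Proof.
have [f0|f0] := eqVneq (L2_norm f) 0.
  by rewrite (L2_norm0_eq0 f0) add0r lerDr lecR sqrtr_ge0.
have [g0|g0] := eqVneq (L2_norm g) 0.
  by rewrite (L2_norm0_eq0 g0) addr0 lerDl lecR sqrtr_ge0.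
have sqrt_gt0 (h : L2) : L2_norm h != 0 -> 0 < Num.sqrt (fine (sqnorm h)).
  move=> h0; rewrite lt0r sqrtr_ge0 andbT; apply: contra h0 => /eqP h0.
  by rewrite /L2_norm h0.
have {f0} := sqrt_gt0 _ f0; have {g0} := sqrt_gt0 _ g0.
rewrite /L2_norm -rmorphD lecR.
have := L2_normK g; have := L2_normK f; have := L2_normK (f + g).
move: (Num.sqrt (fine (sqnorm (f + g)))) (sqrtr_ge0 (fine (sqnorm (f + g)))).
move: (Num.sqrt (fine (sqnorm f))) (Num.sqrt (fine (sqnorm g))).
move=> a b c c0 cE aE bE b0 a0.
have := sqnormD f g a0 b0.
rewrite -[(L2_fun f + L2_fun g)%R]/(L2_fun (f + g)) -cE -aE -bE.
rewrite -!EFinM -EFinD lee_fin => cab.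
rewrite -ler_sqr ?nnegrE ?addr_ge0 ?(ltW a0) ?(ltW b0)//.
apply: (le_trans cab); rewrite le_eqVlt; apply/orP; left; apply/eqP.
by field; rewrite !gt_eqF.
Qed.

Let L2_normZ (a : R[i]) (f : L2) : L2_norm (a *: f) = `|a| * L2_norm f.
Proof.
rewrite /L2_norm -[sqnorm (a *: f)]/(sqnorm (a *: (f : T -> R[i]^o))).
rewrite sqnormZ fineM ?sqnorm_fin ?L2P//= sqrtrM ?sqr_ge0//.
have na0 : 0 <= normc a := @normr_ge0 _ (Rcomplex R) a.
by rewrite sqrtr_sqr ger0_norm// rmorphM.
Qed.

HB.instance Definition _ := Lmodule_isNormed.Build R[i] L2
  L2_ler_normD L2_normZ L2_norm0_eq0.

(* Only meaningful for absolutely summable [h]. *)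
Definition rsum (h : T -> R) : R :=
  fine (\esum_(v in [set: T]) (EFin \o h)^\+ v
        - \esum_(v in [set: T]) (EFin \o h)^\- v)%E.

Definition csum (h : T -> R[i]) : R[i] :=
  rsum (@complex.Re R \o h) +i* rsum (@complex.Im R \o h).

Definition L2_dot (f g : L2) : R[i] :=
  csum (fun v => (f v : R[i]) * (g v)^* * (lam v)%:C).

Lemma L2_dotff (f : L2) : L2_dot f f = `|f| ^+ 2.
Proof.
rewrite -[`|f|]/(L2_norm f) /L2_norm -rmorphXn.
rewrite -[_ ^+ 2]/(fine ((Num.sqrt (fine (sqnorm f)) ^+ 2)%:E) : R) L2_normK.
have dE v : (f v : R[i]) * (f v)^* * (lam v)%:C =
    (normc (f v) ^+ 2 * lam v)%:C.
  case: (f v : R[i]) => x y; rewrite /normc sqr_sqrtr ?addr_ge0 ?sqr_ge0//.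
  by simpc; congr (_ +i* _); ring.
pose h v : R := normc (f v) ^+ 2 * lam v.
have funeneg0 v : (((EFin \o h)^\-) v = 0)%E.
  rewrite (ge0_funenegE (D := setT)) ?inE// => w _ /=.
  exact: sqnorm_term_ge0.
rewrite /L2_dot /csum (_ : (fun v => _) =
    fun v => (normc (f v) ^+ 2 * lam v)%:C); last exact/funext.
congr (_ +i* _); rewrite /rsum.
- rewrite [X in (_ - X)%E](_ : _ = 0%E) ?sube0; last first.
    by apply: esum1 => v _; exact: funeneg0.
  congr fine; apply: eq_esum => v _.
  rewrite (ge0_funeposE (D := setT)) ?inE// => w _ /=.
  exact: sqnorm_term_ge0.
- rewrite !esum1 ?sube0// => v _.
    by rewrite (ge0_funenegE (D := setT)) ?inE.
  by rewrite (ge0_funeposE (D := setT)) ?inE.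
Qed.

End L2.

Section Operators.
Context {R : realType} {T : choiceType} {lam : weight R T}.
Local Notation L2 := (L2 lam).

Definition compact_operator (A : {linear L2 -> L2}) :=
  compact (closure (A @` [set f | `|f| <= 1])).

Definition adjoint (A B : {linear L2 -> L2}) :=
  forall f g, L2_dot (A f) g = L2_dot f (B g).

Definition eigenspace (A : L2 -> L2) (c : R[i]) : set L2 :=
  [set f | A f = c *: f].

Definition has_dim (E : set L2) (d : nat) :=
  exists b : 'I_d -> L2,
    (forall c : 'I_d -> R[i], \sum_i c i *: b i = 0 -> forall i, c i = 0) /\
    E = [set \sum_i c i *: b i | c in [set: 'I_d -> R[i]]].

(* [mu] lists the square roots of the nonzero eigenvalues of A^* A, each
   repeated according to its multiplicity, in any order and with any number of
   zeros interspersed. *)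
Definition singular_values (A : {linear L2 -> L2}) (mu : nat -> R) :=
  (forall n, 0 <= mu n) /\
  exists2 B : {linear L2 -> L2}, adjoint A B &
    forall t : R, 0 < t ->
      exists2 d, has_dim (eigenspace (B \o A) (t ^+ 2)%:C) d &
                 ([set n | mu n = t] #= `I_d)%card.

Definition schatten_class (p : R) : set {linear L2 -> L2} :=
  [set A | compact_operator A /\
    exists2 mu, singular_values A mu &
      (\sum_(0 <= n <oo) (`|mu n| `^ p)%:E < +oo)%E].

End Operators.

Section Composition.
Context {R : realType} {T : choiceType} (lam : weight R T) (phi : T -> T).

(* The composition operator maps L2 into itself; this is implicit in saying that
   it is compact on L2. *)
Definition L2_stable := forall f : L2 lam, (f \o phi) \in L2_pred lam.

Definition comp_op (stab : L2_stable) (f : L2 lam) : L2 lam := MkL2 (stab f).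

Lemma comp_op_is_linear (stab : L2_stable) : linear (comp_op stab).
Proof. by move=> a f g; apply/val_inj/funext. Qed.

HB.instance Definition _ (stab : L2_stable) :=
  GRing.isLinear.Build R[i] (L2 lam) (L2 lam) *:%R (comp_op stab)
    (comp_op_is_linear stab).

(* Intended for injective [phi], where the preimage chosen below is unique. *)
Definition preimage_weight (u : T) : R :=
  if pselect (exists w, phi w = u) is left phi_u then lam (projT1 (cid phi_u))
  else 0.

End Composition.

(* Main.v *)
(* For injective [phi], [C^* C] is multiplication by the ratio
   [r u = lambda (phi^-1 u) / lambda u]. Its eigenspace for [t ^ 2 > 0] is spanned
   by the point masses on the level set [r = t ^ 2], which is finite because
   [r ^ (p / 2)] is summable; so the values [sqrt (r u)], listed along any
   enumeration of the vertices, are the singular values, and their [p]-th powers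
   are exactly the terms of the summable family. *)
Require Import Defs.
From HB Require Import structures.
From mathcomp Require Import all_boot all_order all_algebra finmap.
From mathcomp Require Import all_classical all_reals all_analysis.
From mathcomp Require Import ring complex.
Import Order.TTheory GRing.Theory Num.Theory numFieldNormedType.Exports.
Import ComplexField.Normc.
Local Open Scope classical_set_scope.
Local Open Scope ring_scope.

(** * Sums over index types: reindexing and counting *)

Lemma esum_comp_inj {R : realType} {T : choiceType} {phi : T -> T}
    (h : T -> \bar R) :
  injective phi -> (forall u, ~ range phi u -> h u = 0%E) ->
  (\esum_(u in [set: T]) h u = \esum_(v in [set: T]) h (phi v))%E.
Proof.
move=> phi_inj h0; rewrite -(esum_image _ _ h (in2W phi_inj)) [RHS]esum_mkcond.
by apply: eq_esum => u _; case: ifPn => // /negP; rewrite inE => /h0.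
Qed.

Lemma esum_point_ub {R : realType} {T : choiceType} {a : T -> \bar R} (u : T) :
  (forall v, 0 <= a v)%E -> (a u <= \esum_(v in [set: T]) a v)%E.
Proof.
move=> a0; rewrite (esumID [set u])// setTI esum_set1// leeDl//.
exact: esum_ge0.
Qed.

(** Markov's inequality: [k] points where [a] is at least [c] contribute at least [k * c] to the
    sum, so [k] is at most the sum divided by [c]. *)
Lemma finite_superlevel_esum {R : realType} {T : choiceType} {a : T -> R}
    {c : R} :
  0 < c -> (forall v, 0 <= a v) -> (\esum_(v in [set: T]) (a v)%:E < +oo)%E ->
  finite_set [set v | c <= a v].
Proof.
move=> c0 a0 aoo; apply: contrapT => /infinite_set_fset Bex.
have S0 : (0 <= \esum_(v in [set: T]) (a v)%:E)%E.
  by apply: esum_ge0 => v _; rewrite lee_fin.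
pose S := fine (\esum_(v in [set: T]) (a v)%:E)%E.
have SE : (\esum_(v in [set: T]) (a v)%:E = S%:E)%E.
  by rewrite fineK// ge0_fin_numE.
have [B Bsub Bcard] := Bex (Num.truncn (S / c)).+1.
have : (\sum_(v \in [set` B]) (a v)%:E <= S%:E)%E.
  by rewrite -SE; apply: esum_ge; exists [set` B].
apply/negP; rewrite -ltNge fsbig_finite//= set_fsetK.
rewrite sumEFin lte_fin.
apply: (@lt_le_trans _ _ (\sum_(v <- B) c)); last first.
  by rewrite big_seq [leRHS]big_seq; apply: ler_sum => v vB; exact: Bsub.
rewrite big_const_seq count_predT iter_addr_0 -mulr_natl -ltr_pdivrMr//.
apply: (lt_le_trans (truncnS_gt _)); rewrite ler_nat//.
Qed.

(** The positive and negative parts of the real and imaginary parts all vanish off the range, so the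
    nonnegative change of variables applies to each of the four sums. This reindexes the inner
    product with [C^* g] by [u = phi v]. *)
Lemma csum_comp_inj {R : realType} {T : choiceType} {phi : T -> T}
    (h : T -> R[i]) :
  injective phi -> (forall u, ~ range phi u -> h u = 0) ->
  csum h = csum (h \o phi).
Proof.
move=> phi_inj h0.
have rsumE (k : T -> R) : (forall u, ~ range phi u -> k u = 0) ->
    rsum k = rsum (k \o phi).
  move=> k0; rewrite /rsum (esum_comp_inj (funepos (EFin \o k)) phi_inj).
    rewrite (esum_comp_inj (funeneg (EFin \o k)) phi_inj).
      congr (fine (_ - _)%E); apply: eq_esum => v _.
        by rewrite !funeposE.
      by rewrite !funenegE.
    by move=> u /k0 ku; rewrite funenegE /= ku oppr0 maxxx.
  by move=> u /k0 ku; rewrite funeposE /= ku maxxx.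
by congr (_ +i* _)%C; apply: rsumE => u /h0 hu /=; rewrite hu.
Qed.

(** * Eigenspaces of diagonal operators *)

Section diagonal.
Context {R : realType} {T : choiceType} {lam : weight R T}.
Implicit Types f g : L2 lam.

Definition point_mass (u : T) : T -> R[i]^o := fun v => (v == u)%:R.

Lemma point_mass_L2 (u : T) : point_mass u \in L2_pred lam.
Proof.
rewrite unfold_in /sqnorm.
rewrite [ltLHS](_ : _ = (lam u)%:E) ?ltry//.
rewrite -[RHS](esum_set1 (a := EFin \o lam)) ?lee_fin ?ltW ?weight_gt0//.
rewrite [RHS]esum_mkcond; apply: eq_esum => v _.
rewrite /point_mass in_set1 /=; case: eqVneq => _.
  by rewrite ComplexField.Normc.normc1 expr1n mul1r.
by rewrite ComplexField.Normc.normc0 expr0n mul0r.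
Qed.

Definition L2_point_mass (u : T) : L2 lam := MkL2 (point_mass_L2 u).

Lemma L2_sumE (n : nat) (c : 'I_n -> R[i]) (b : 'I_n -> L2 lam) (v : T) :
  (\sum_i c i *: b i) v = \sum_i c i * (b i v : R[i]).
Proof.
pose ev (f : L2 lam) : R[i] := f v.
rewrite -[LHS]/(ev _) (big_morph ev (id1 := 0) (op1 := +%R))//.
Qed.

(** The point masses on the level set form a basis of the eigenspace; presenting that set as [A]
    encodes its finiteness. *)
Lemma has_dim_diagonal_eigenspace (D : L2 lam -> L2 lam) (w : T -> R) (c : R) :
  (forall f u, (D f) u = (w u)%:C%C * (f u : R[i]) :> R[i]) ->
  forall A : {fset T}, [set` A] = [set u | w u = c] ->
  has_dim (Defs.eigenspace D c%:C%C) #|` A|.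
Proof.
move=> DE A AE.
have memA u : (u \in A) = (w u == c).
  by apply/idP/eqP => [uA|wu]; [have : [set` A] u by []; rewrite AE|
     have : [set u | w u = c] u by []; rewrite -AE].
pose s i := tnth (in_tuple A) i.
have s_inj : injective s by apply/tuple_uniqP; exact: fset_uniq.
exists (fun i => L2_point_mass (s i)); split.
  (* Evaluating the vanishing combination at the point [s i] isolates the coefficient [k i]. *)
  move=> k k0 i; have /(congr1 (fun f : L2 lam => f (s i) : R[i])) := k0.
  rewrite L2_sumE (bigD1 i)//= /point_mass eqxx mulr1 big1 ?addr0// => j ji.
  by rewrite (inj_eq s_inj) eq_sym (negbTE ji) mulr0.
apply/seteqP; split => [f Df|_ [k _ <-]].
- exists (fun i => f (s i)) => //; apply/val_inj/funext => v /=.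
  rewrite L2_sumE -(big_tnth _ _ _ predT (fun u => (f u : R[i]) * point_mass u v)).
  have [vA|vA] := boolP (v \in A).
    rewrite (bigD1_seq v)//= /point_mass eqxx mulr1 big1 ?addr0// => u uv.
    by rewrite eq_sym (negbTE uv) mulr0.
  rewrite big_seq big1 => [|u uA]; last first.
    by rewrite /point_mass (_ : v == u = false) ?mulr0//; apply: contraNF vA => /eqP->.
  (* Off the level set [w v - c] is nonzero, so the eigenvalue equation at [v] forces [f v = 0]. *)
  have : (w v)%:C%C * (f v : R[i]) = c%:C%C * (f v : R[i]) by rewrite -DE Df.
  move/eqP; rewrite -subr_eq0 -mulrBl mulf_eq0 => /orP[|/eqP->//].
  rewrite subr_eq0 => /eqP[] wv; by move: vA; rewrite memA wv eqxx.
- apply/val_inj/funext => v; rewrite [LHS]DE.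
  rewrite -[RHS]/(c%:C%C * ((\sum_i k i *: L2_point_mass (s i)) v : R[i])).
  rewrite L2_sumE !mulr_sumr; apply: eq_bigr => i _.
  rewrite /= /point_mass; case: eqVneq => [->|_]; last by rewrite !mulr0.
  have : s i \in A by rewrite /s mem_tnth.
  by rewrite memA => /eqP ->.
Qed.

End diagonal.

(** * The adjoint of a composition operator with injective symbol *)

Section composition_adjoint.
Context {R : realType} {T : choiceType} {lam : weight R T} {phi : T -> T}.
Context (phi_inj : injective phi).

Lemma preimage_weight_image (v : T) : preimage_weight lam phi (phi v) = lam v.
Proof.
rewrite /preimage_weight; case: pselect => [E|[]]; last by exists v.
by rewrite (phi_inj _ _ (projT2 (cid E))).
Qed.

Lemma preimage_weight_notin_range (u : T) :
  ~ range phi u -> preimage_weight lam phi u = 0.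
Proof.
rewrite /preimage_weight; case: pselect => // -[v vu] nu.
by case: nu; exists v.
Qed.

Lemma preimage_weight_ge0 (u : T) : 0 <= preimage_weight lam phi u.
Proof.
by rewrite /preimage_weight; case: pselect => // E; rewrite ltW// weight_gt0.
Qed.

Let ratio (u : T) : R := preimage_weight lam phi u / lam u.

Let ratio_ge0 (u : T) : 0 <= ratio u.
Proof. by rewrite divr_ge0 ?preimage_weight_ge0// ltW// weight_gt0. Qed.

(** This is the formula for [C^* g]. Pairing with the point mass at [u] forces
    [lam u * (C^* g) u = lam w * g w] when [phi w = u], and [(C^* g) u = 0] when [u] is outside the
    range. *)
Definition push_forward (g : T -> R[i]^o) : T -> R[i]^o := fun u =>
  if pselect (exists w, phi w = u) is left phi_u
  then (preimage_weight lam phi u / lam u)%:C%C * (g (projT1 (cid phi_u)) : R[i])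
  else 0.

Lemma push_forward_image (g : T -> R[i]^o) (v : T) :
  push_forward g (phi v) = (ratio (phi v))%:C%C * (g v : R[i]) :> R[i].
Proof.
rewrite /push_forward; case: pselect => [E|[]]; last by exists v.
by rewrite (phi_inj _ _ (projT2 (cid E))).
Qed.

Lemma push_forward_notin_range (g : T -> R[i]^o) (u : T) :
  ~ range phi u -> push_forward g u = 0 :> R[i].
Proof.
rewrite /push_forward; case: pselect => // -[v vu] nu.
by case: nu; exists v.
Qed.

Lemma push_forward_L2 (M : R) :
  0 <= M -> (forall u, preimage_weight lam phi u / lam u <= M) ->
  forall g : L2 lam, push_forward g \in L2_pred lam.
Proof.
move=> M0 leM g; rewrite unfold_in.
rewrite /sqnorm (esum_comp_inj _ phi_inj); last first.
  move=> u /(push_forward_notin_range g) ->.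
  by rewrite normc0 expr0n mul0r.
apply: (@le_lt_trans _ _ (M%:E * sqnorm lam g)%E); last first.
  by rewrite lte_mul_pinfty ?lee_fin//; exact: L2P.
have term_ge0 v : 0 <= normc (g v) ^+ 2 * lam v.
  by rewrite mulr_ge0 ?sqr_ge0// ltW// weight_gt0.
rewrite /sqnorm -ge0_esumZl//.
apply: le_esum => v _; rewrite -EFinM lee_fin push_forward_image normcM exprMn.
have -> : normc (ratio (phi v))%:C%C = ratio (phi v).
  by rewrite /normc /= expr0n addr0 sqrtr_sqr ger0_norm.
(* Since [ratio (phi v) * lam (phi v) = lam v], one factor of the ratio is absorbed by the change of
   weight; the other is bounded by [M]. *)
have -> : ratio (phi v) ^+ 2 * normc (g v) ^+ 2 * lam (phi v) =
    ratio (phi v) * (normc (g v) ^+ 2 * lam v).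
  rewrite /ratio preimage_weight_image; field.
  by rewrite gt_eqF// weight_gt0.
apply: ler_wpM2r; [exact: term_ge0|exact: leM].
Qed.

Context {M : R} (M_ge0 : 0 <= M).
Context (ratio_le : forall u, preimage_weight lam phi u / lam u <= M).

Definition comp_adjoint (g : L2 lam) : L2 lam :=
  MkL2 (push_forward_L2 M M_ge0 ratio_le g).

Lemma comp_adjoint_is_linear : linear comp_adjoint.
Proof.
move=> a f g; apply/val_inj/funext => u /=.
have [[v _ <-]|nu] := pselect (range phi u).
  rewrite -[RHS]/(a * (push_forward f (phi v) : R[i]) + push_forward g (phi v)).
  rewrite !push_forward_image.
  rewrite -[LHS]/((ratio (phi v))%:C%C * (a * (f v : R[i]) + g v)).
  by rewrite mulrDr mulrCA.
rewrite -[RHS]/(a * (push_forward f u : R[i]) + push_forward g u).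
by rewrite !push_forward_notin_range// mulr0 addr0.
Qed.

HB.instance Definition _ := GRing.isLinear.Build R[i] (L2 lam) (L2 lam) *:%R
  comp_adjoint comp_adjoint_is_linear.

(** After reindexing by [u = phi v], the real factor [ratio (phi v)] turns the weight [lam (phi v)]
    into [lam v], and the summands agree. *)
Lemma adjoint_comp_op (stab : L2_stable lam phi) :
  adjoint (comp_op stab) comp_adjoint.
Proof.
move=> f g; rewrite /L2_dot [RHS](csum_comp_inj _ phi_inj); last first.
  by move=> u nu; rewrite /= push_forward_notin_range// conjC0 mulr0 mul0r.
congr csum; apply/funext => v /=.
rewrite push_forward_image rmorphM /= [in RHS](conjc_real _ : Num.conj _ = _) -!mulrA; congr (_ * _).
rewrite mulrCA; congr (_ * _); rewrite -rmorphM /ratio preimage_weight_image.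
by rewrite divfK// gt_eqF// weight_gt0.
Qed.

Lemma comp_adjoint_comp_op (stab : L2_stable lam phi) (f : L2 lam) (u : T) :
  (comp_adjoint \o comp_op stab) f u =
    (preimage_weight lam phi u / lam u)%:C%C * (f u : R[i]) :> R[i].
Proof.
have [[v _ <-]|nu] := pselect (range phi u).
  exact: push_forward_image.
rewrite /= push_forward_notin_range// preimage_weight_notin_range//.
by rewrite mul0r rmorph0 mul0r.
Qed.

End composition_adjoint.

(** * Enumeration of the vertices, boundedness of the ratio, and the conclusion *)

Lemma countable_infinite_bijection {T : choiceType} :
  countable [set: T] -> infinite_set [set: T] ->
  exists e : nat -> T, bijective e.
Proof.
move=> Tcount Tinf.
have /card_set_bijP[f] := eq_card_nat Tcount Tinf.
by rewrite setTT_bijective => -[e fK eK]; exists e, f.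
Qed.

(** Each term is at most the whole sum [S], so [a u] is at most [S] to the power [1 / q]. *)
Lemma bounded_of_esum_powR {R : realType} {T : choiceType} {a : T -> R}
    {q : R} :
  0 < q -> (forall u, 0 <= a u) ->
  (\esum_(u in [set: T]) (a u `^ q)%:E < +oo)%E ->
  exists2 M, 0 <= M & forall u, a u <= M.
Proof.
move=> q0 a0 aoo; pose S := (\esum_(u in [set: T]) (a u `^ q)%:E)%E.
have pow0 u : (0 <= (a u `^ q)%:E)%E by rewrite lee_fin powR_ge0.
have S0 : (0 <= S)%E by apply: esum_ge0.
exists (fine S `^ q^-1) => [|u]; first exact: powR_ge0.
rewrite -[a u]powRr1// -(divff (lt0r_neq0 q0)) powRrM.
apply: ge0_ler_powR; rewrite ?nnegrE ?powR_ge0 ?fine_ge0 ?invr_ge0 ?(ltW q0)//.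
by rewrite -lee_fin fineK ?ge0_fin_numE//; apply: esum_point_ub.
Qed.

Theorem theorem4p7 (R : realType) (p : R) (T : tree) (lambda : weight R T)
    (phi : T -> T) (stab : L2_stable lambda phi) :
  1 <= p < 2 ->
  injective phi ->
  compact_operator (comp_op stab) ->
  (\esum_(u in [set: T])
     ((preimage_weight lambda phi u / lambda u) `^ (p / 2))%:E < +oo)%E ->
  schatten_class p (comp_op stab).
Proof.
move=> /andP[p_ge1 _] phi_inj comp_cpt ratio_sum.
have q_gt0 : 0 < p / 2 by rewrite divr_gt0// (lt_le_trans ltr01).
pose r u := preimage_weight lambda phi u / lambda u.
have r_ge0 u : 0 <= r u.
  by rewrite divr_ge0 ?preimage_weight_ge0// ltW// weight_gt0.
(* This bound is what lets [push_forward] map [L2] into itself. *)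
have [M M_ge0 r_le] := bounded_of_esum_powR q_gt0 r_ge0 ratio_sum.
(* A bijection lists every vertex exactly once, so multiplicities are counted correctly. *)
have [e e_bij] :=
  countable_infinite_bijection (@tree_countable T) (@tree_infinite T).
split=> //; exists (fun n => Num.sqrt (r (e n))); last first.
  (* Summability transfers through [e], because [sqrt x] to the power [p] equals [x] to the power
     [p / 2]. *)
  rewrite nneseries_esumT; last by move=> n; rewrite lee_fin powR_ge0.
  have e_setbij : set_bij [set: nat] [set: T] e by rewrite setTT_bijective.
  rewrite (reindex_esum _ _ _ _ e_setbij) in ratio_sum.
  apply: le_lt_trans ratio_sum; apply: le_esum => n _.
  rewrite lee_fin ger0_norm ?sqrtr_ge0// -powR12_sqrt//.
  by rewrite -powRrM mulrC.
split=> [n|]; first exact: sqrtr_ge0.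
exists (comp_adjoint phi_inj M_ge0 r_le); first exact: adjoint_comp_op.
(* Vertices with [r u = 0] only produce zero entries, which the restriction to [t > 0] ignores. *)
move=> t t_gt0.
(* On the level set the summand is the positive constant [(t ^ 2) ^ (p / 2)], so the set lies in a
   superlevel set of the summable family. *)
have level_fin : finite_set [set u | r u = t ^+ 2].
  have c_gt0 : 0 < (t ^+ 2) `^ (p / 2) by rewrite powR_gt0// exprn_gt0.
  apply: sub_finite_set
    (finite_superlevel_esum c_gt0 (fun u => powR_ge0 _ _) ratio_sum).
  by move=> u /= <-.
have level_eq : [set u | r u = t ^+ 2] = e @` [set n | Num.sqrt (r (e n)) = t].
  apply/seteqP; split => [u ru|_ [n nt <-] /=].
    have [e' eK e'K] := e_bij; exists (e' u) => //=.
    by rewrite e'K ru sqrtr_sqr gtr0_norm.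
  by rewrite -nt sqr_sqrtr.
exists #|` fset_set [set u | r u = t ^+ 2]|%fset.
  apply: (has_dim_diagonal_eigenspace _ r).
    exact: comp_adjoint_comp_op.
  exact: fset_setK.
(* Injectivity of [e] matches the indices with the level set, whose cardinality is the dimension. *)
apply: (card_eq_trans (B := [set u | r u = t ^+ 2])).
  rewrite level_eq; apply: card_esym; apply: inj_card_eq.
  by apply: in2W; exact: bij_inj.
by rewrite -{1}[X in (X #= _)%card](fset_setK level_fin); apply/card_eq_fsetP.
Qed.
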